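(* Let $\mathcal{H}$ be a complex separable Hilbert space, let $\mathcal{K}$ and $\mathcal{E}$ be complex Krein spaces, and let $T:\mathcal{H}\to\mathcal{K}$ and $V:\mathcal{H}\to\mathcal{E}$ be bounded surjective linear operators such that $V^\#V$ is indefinite. Let $\mathcal{C}_V=\{u\in\mathcal{H}: [Vu,Vu]_{\mathcal{E}}=0\}$ and $\mathcal{P}^+(\mathcal{K})=\{y\in\mathcal{K}: [y,y]_{\mathcal{K}}\ge 0\}$. Then the following conditions are equivalent: (1) $T(\mathcal{C}_V)\subseteq\mathcal{P}^+(\mathcal{K})$; (2) there exists $\rho\in\mathbb{R}$ such that $T^\#T+\rho V^\#V\in\mathcal{L}(\mathcal{H})^+$.
   Context: A Krein space is a complex vector space $\mathcal{F}$ with a Hermitian sesquilinear form $[\cdot,\cdot]_{\mathcal{F}}$ that admits a fundamental decomposition $\mathcal{F}=\mathcal{F}_+\dotplus\mathcal{F}_-$, where $\mathcal{F}_+$ and $\mathcal{F}_-$ are orthogonal with respect to $[\cdot,\cdot]_{\mathcal{F}}$ and $(\mathcal{F}_+,[\cdot,\cdot])$, $(\mathcal{F}_-,-[\cdot,\cdot])$ are Hilbert spaces. Topological notions refer to the norm of the Hilbert space direct sum of these two spaces (the topology does not depend on the decomposition). For a bounded operator $T:\mathcal{H}\to\mathcal{K}$ from the Hilbert space $(\mathcal{H},\langle\cdot,\cdot\rangle)$ to the Krein space $\mathcal{K}$, $T^\#:\mathcal{K}\to\mathcal{H}$ is the bounded operator with $[Tx,y]_{\mathcal{K}}=\langle x,T^\#y\rangle$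 for all $x\in\mathcal{H}$, $y\in\mathcal{K}$; $V^\#$ is defined similarly. $\mathcal{L}(\mathcal{H})^+$ is the set of bounded positive semidefinite operators on $\mathcal{H}$. $V^\#V$ is indefinite if it is neither positive nor negative semidefinite. *)

(* Defs.v *)
From HB Require Import structures.
From mathcomp Require Import all_boot all_order all_algebra.
From mathcomp Require Import complex.
From mathcomp Require Import all_classical all_reals topology normedtype.

Set Implicit Arguments.
Unset Strict Implicit.
Unset Printing Implicit Defensive.

Import Order.TTheory GRing.Theory Num.Theory.
Import numFieldNormedType.Exports.

Local Open Scope classical_set_scope.
Local Open Scope ring_scope.
Local Open Scope complex_scope.

(* The order of R[i] is the partial one: 0 <= z says that z is real and
   nonnegative. Norms are therefore R[i]-valued, as in normedModType R[i],
   and sqrtC restricted to nonnegative reals is the usual square root.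
   {hermitian _ for false & Num.conj} and {dot _ for Num.conj} are linear in the
   first argument and conjugate-linear in the second. *)

Section Operators.
Context {R : realType} {U W : lmodType R[i]}.

Definition bounded_operator (nU : U -> R[i]) (nW : W -> R[i]) (f : U -> W) :=
  linear f /\ exists M : R, forall x, nW (f x) <= M%:C * nU x.

End Operators.

Section KreinSpaces.
Context {R : realType} {F : lmodType R[i]}.

Definition complete_for (n : F -> R[i]) (A : set F) :=
  forall u : nat -> F, (forall k, A (u k)) ->
    (forall e : R, 0 < e -> exists N : nat, forall i j : nat,
        (N <= i)%N -> (N <= j)%N -> n (u i - u j) < e%:C) ->
    exists2 l, A l & forall e : R, 0 < e ->
      exists N : nat, forall i : nat, (N <= i)%N -> n (u i - l) < e%:C.

(* To be used with ip a Hermitian sesquilinear form on F. *)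
Definition hilbert_subspace (ip : F -> F -> R[i]) (A : set F) :=
  [/\ A 0,
      forall (a : R[i]) x y, A x -> A y -> A (a *: x + y),
      forall x, A x -> x != 0 -> 0 < ip x x
    & complete_for (fun x => sqrtC (ip x x)) A].

Definition is_split (Fp Fm : set F) (x : F) (uv : F * F) :=
  [/\ Fp uv.1, Fm uv.2 & x = uv.1 + uv.2].

Definition fundamental_decomposition
    (q : {hermitian F for false & Num.conj}) (Fp Fm : set F) :=
  [/\ hilbert_subspace q Fp,
      hilbert_subspace (fun x y => - q x y) Fm,
      forall u v, Fp u -> Fm v -> q u v = 0
    & forall x, exists! uv, is_split Fp Fm x uv].

Definition krein_space (q : {hermitian F for false & Num.conj}) :=
  exists Fp Fm, fundamental_decomposition q Fp Fm.

Definition decomposition_norm (q : {hermitian F for false & Num.conj})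
    (Fp Fm : set F) (x : F) : R[i] :=
  let uv := xget (0, 0) [set uv | is_split Fp Fm x uv] in
  sqrtC (q uv.1 uv.1 - q uv.2 uv.2).

(* All norms n with krein_norm q n are equivalent, so that boundedness of an
   operator may be tested with any of them. *)
Definition krein_norm (q : {hermitian F for false & Num.conj}) (n : F -> R[i]) :=
  exists Fp Fm,
    fundamental_decomposition q Fp Fm /\ n = decomposition_norm q Fp Fm.

Definition nonneg_vectors (q : {hermitian F for false & Num.conj}) : set F :=
  [set y | 0 <= q y y].

Definition neutral_preimage (H : Type) (q : {hermitian F for false & Num.conj})
    (V : H -> F) : set H :=
  [set u | q (V u) (V u) = 0].

End KreinSpaces.

Section HilbertSpaces.
Context {R : realType} {H : completeNormedModType R[i]}.

Definition hilbert_space (ip : {dot H for Num.conj}) :=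
  forall x : H, `|x| ^+ 2 = ip x x.

Definition separable := exists2 D : set H, countable D & dense D.

Definition positive_semidefinite (ip : {dot H for Num.conj}) (A : H -> H) :=
  forall x, 0 <= ip (A x) x.

Definition negative_semidefinite (ip : {dot H for Num.conj}) (A : H -> H) :=
  forall x, ip (A x) x <= 0.

Definition indefinite (ip : {dot H for Num.conj}) (A : H -> H) :=
  ~ positive_semidefinite ip A /\ ~ negative_semidefinite ip A.

Definition bounded_positive (ip : {dot H for Num.conj}) : set (H -> H) :=
  [set A | bounded_operator Num.norm Num.norm A
           /\ positive_semidefinite ip A].

Context {F : lmodType R[i]}.

Definition bounded_to_krein (q : {hermitian F for false & Num.conj})
    (T : H -> F) :=
  exists2 n, krein_norm q n & bounded_operator Num.norm n T.

Definition bounded_from_krein (q : {hermitian F for false & Num.conj})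
    (S : F -> H) :=
  exists2 n, krein_norm q n & bounded_operator n Num.norm S.

Definition is_adjoint (ip : {dot H for Num.conj})
    (q : {hermitian F for false & Num.conj}) (T : H -> F) (S : F -> H) :=
  bounded_from_krein q S /\ forall x y, q (T x) y = ip x (S y).

(* T^#. It is characterized by is_adjoint when H is a Hilbert space, F is a
   Krein space and T is bounded (Riesz); the value is irrelevant otherwise. *)
Definition adjoint (ip : {dot H for Num.conj})
    (q : {hermitian F for false & Num.conj}) (T : H -> F) : F -> H :=
  xget (fun=> 0) [set S | is_adjoint ip q T S].

End HilbertSpaces.

Arguments separable {R} H.

(* Main.v *)
(* With a x = [Tx, Tx] and b x = [Vx, Vx], condition (2) asks for a real rho with
   a + rho b >= 0. If b x > 0 > b y, scale and rotate y by a complex number c so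
   that b (c y) = - b x and the mixed term of b (x + c y) is imaginary; then x + c y
   and x - c y are both neutral for b, and adding a (x + c y) >= 0 and
   a (x - c y) >= 0 gives - a x / b x <= a y / (- b y). Hence the supremum of the
   left-hand sides is a suitable rho. The remaining work is that V^# and T^# exist,
   which is the Riesz representation theorem. *)
Require Import Defs.
From HB Require Import structures.
From mathcomp Require Import all_boot all_order all_algebra.
From mathcomp Require Import complex.
From mathcomp Require Import all_classical all_reals topology normedtype.
From mathcomp Require Import ring lra.

Set Implicit Arguments.
Unset Strict Implicit.
Unset Printing Implicit Defensive.

Import Order.TTheory GRing.Theory Num.Theory.
Import numFieldNormedType.Exports.

Local Open Scope classical_set_scope.
Local Open Scope complex_scope.
Local Open Scope ring_scope.

(** * Hermitian forms and the Cauchy-Schwarz inequality *)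

Section HermitianForms.
Context {C : numClosedFieldType} {F : lmodType C}.

Lemma herm_conj (q : {hermitian F for false & Num.conj}) x y :
  q x y = (q y x)^*.
Proof. by rewrite hermC expr0 mul1r. Qed.

Lemma herm_real (q : {hermitian F for false & Num.conj}) x :
  q x x \is Num.real.
Proof. by apply/CrealP; rewrite -herm_conj. Qed.

Lemma herm_qualD (q : {hermitian F for false & Num.conj}) x y (c : C) :
  q (x + c *: y) (x + c *: y) =
  q x x + (c * q y x + (c * q y x)^*) + c * c^* * q y y.
Proof.
rewrite !(linearDl, linearDr) !(linearZl_LR, linearZr_LR) /=.
rewrite rmorphM /=.
by rewrite -herm_conj; ring.
Qed.

(** Expand [f] at the vector [f v v *: u - f u v *: v] of [A] and cancel the factor [f v v]. A bare
    function on a set serves three uses: a Krein form on its positive part, the negated form on its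
    negative part, and the inner product of [H]. *)
Lemma cauchy_schwarz_on (f : F -> F -> C) (A : set F)
    (f_lin : forall a x y z, f (a *: x + y) z = a * f x z + f y z)
    (f_conj : forall x y, f x y = (f y x)^*)
    (A0 : A 0) (A_lin : forall (a : C) x y, A x -> A y -> A (a *: x + y))
    (f_gt0 : forall x, A x -> x != 0 -> 0 < f x x) (u v : F) :
  A u -> A v -> `|f u v| ^+ 2 <= f u u * f v v.
Proof.
move=> Au Av.
have f0l z : f 0 z = 0.
  have := f_lin 1 0 0 z; rewrite scaler0 addr0 mul1r => /eqP.
  by rewrite -subr_eq0 opprD addNKr oppr_eq0 => /eqP.
have f_ge0 x : A x -> 0 <= f x x.
  by have [->|x0 Ax] := eqVneq x 0; [rewrite f0l | exact/ltW/f_gt0].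
have [v0|v0] := eqVneq v 0.
  by rewrite f_conj v0 !f0l rmorph0 normr0 expr0n mulr0.
have fv0 := f_gt0 _ Av v0.
have fr a x y z : f z (a *: x + y) = a^* * f z x + f z y.
  by rewrite f_conj f_lin rmorphD rmorphM /= -!f_conj.
have Av' : A (- f u v *: v).
  by have := A_lin (- f u v) v 0 Av A0; rewrite addr0.
have := f_ge0 _ (A_lin (f v v) _ _ Au Av').
(* The added zero gives this term the shape [a *: x + y] that [f_lin] rewrites. *)
have -> : - f u v *: v = - f u v *: v + 0 by rewrite addr0.
rewrite !(f_lin, fr) !f0l !(f_conj _ 0) !f0l rmorph0 rmorphN /=.
rewrite -(f_conj v u) -(f_conj v v) normCK -(f_conj v u).
set d := (X in 0 <= X -> _).
suff -> : d = f v v * (f u u * f v v - f u v * f v u).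
  by rewrite pmulr_rge0 // subr_ge0.
rewrite {}/d; ring.
Qed.

End HermitianForms.

(** * The S-lemma for two Hermitian forms *)

Section SLemma.
Context {R : realType} {X K E : lmodType R[i]}.
Context (qK : {hermitian K for false & Num.conj}).
Context (qE : {hermitian E for false & Num.conj}).
Context (T : {linear X -> K}) (V : {linear X -> E}).

Lemma rotate_to_imaginary (w r : R[i]) (r_ge0 : 0 <= r) :
  exists c : R[i], c * c^* = r /\ c * w + (c * w)^* = 0.
Proof.
have rr : sqrtC r * (sqrtC r)^* = r.
  by rewrite conj_Creal ?ger0_real ?sqrtC_ge0 // -expr2 sqrtCK.
have [->|w0] := eqVneq w 0.
  by exists (sqrtC r); rewrite mulr0 rmorph0 addr0.
have nw0 : `|w| != 0 by rewrite normr_eq0.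
have nwr : (`|w|)^* = `|w| :> R[i] by rewrite conj_Creal // normr_real.
(* The normalized conjugate of [w] turns [w] onto the positive real axis, ['i] turns it on to the
   imaginary one, and [sqrtC r] sets the modulus. *)
exists (sqrtC r * 'i * w^* / `|w|); split.
  rewrite !rmorphM fmorphV /= nwr conjCi conjCK.
  transitivity ((sqrtC r * (sqrtC r)^*) * (- 'i ^+ 2) * (w * w^* / `|w| ^+ 2)).
    by field.
  by rewrite rr sqrCi opprK mulr1 normCK divff ?mulr1 // -normCK expf_neq0.
have -> : sqrtC r * 'i * w^* / `|w| * w = sqrtC r * 'i * `|w|.
  transitivity (sqrtC r * 'i * (w * w^*) / `|w|); first by ring.
  by rewrite -normCK; field.
rewrite !rmorphM /= conjCi nwr (conj_Creal (x := sqrtC r)) ?ger0_real ?sqrtC_ge0 //.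
ring.
Qed.

Hypothesis neutral_ge0 : forall x, qE (V x) (V x) = 0 -> 0 <= qK (T x) (T x).

Lemma neutral_pair_ge0 x y : 0 < qE (V x) (V x) -> qE (V y) (V y) < 0 ->
  0 <= qK (T x) (T x) / qE (V x) (V x) - qK (T y) (T y) / qE (V y) (V y).
Proof.
set p := qE (V x) (V x); set m := qE (V y) (V y) => p0 m0.
have r0 : 0 <= - (p / m).
  by rewrite -mulrN -invrN divr_ge0 ?ltW // oppr_gt0.
have [c [cc cw]] := rotate_to_imaginary (qE (V y) (V x)) r0.
have TD d : T (x + d *: y) = T x + d *: T y by rewrite linearD linearZ.
have VD d : V (x + d *: y) = V x + d *: V y by rewrite linearD linearZ.
have pm0 : p + - (p / m) * m = 0 by rewrite mulNr divfK ?lt_eqF // subrr.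
have h1 := @neutral_ge0 (x + c *: y); have h2 := @neutral_ge0 (x + - c *: y).
move: h1 h2; rewrite !TD !VD !herm_qualD !mulNr !rmorphN /= -!opprD cw.
rewrite !mulrN mulNr opprK cc -/p -/m oppr0 addr0 => /(_ pm0) h1 /(_ pm0) h2.
(* The mixed terms of [qK] cancel in the sum, leaving [2 * (qK (T x) (T x) - p / m * qK (T y) (T
   y))]. *)
have := addr_ge0 h1 h2.
set S := (X in 0 <= X -> _).
suff -> : S = 2 * p * (qK (T x) (T x) / p - qK (T y) (T y) / m).
  by rewrite pmulr_rge0 // mulr_gt0.
by rewrite {}/S; field; rewrite lt_eqF ?gt_eqF.
Qed.

Lemma s_lemma : (exists x, 0 < qE (V x) (V x)) ->
  (exists y, qE (V y) (V y) < 0) ->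
  exists rho : R, forall x, 0 <= qK (T x) (T x) + rho%:C * qE (V x) (V x).
Proof.
move=> [x0 bx0] [y0 by0].
pose a x := complex.Re (qK (T x) (T x)); pose b x := complex.Re (qE (V x) (V x)).
have aE x : qK (T x) (T x) = (a x)%:C by rewrite RRe_real ?herm_real.
have bE x : qE (V x) (V x) = (b x)%:C by rewrite RRe_real ?herm_real.
have key x y : 0 < b x -> b y < 0 -> - (a x / b x) <= - (a y / b y).
  move=> bx bY; have := @neutral_pair_ge0 x y.
  rewrite !aE !bE !ltcR -!fmorphV -!rmorphM -rmorphB ler0c => /(_ bx bY).
  by rewrite lerN2 subr_ge0.
move: bx0 by0; rewrite !bE !ltcR => bx0 by0.
pose S := [set - (a x / b x) | x in [set x | 0 < b x]].
have S0 : S !=set0 by exists (- (a x0 / b x0)); exists x0.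
have ubS y : b y < 0 -> ubound S (- (a y / b y)).
  by move=> bY _ [x bx <-]; exact: key.
exists (sup S) => x; rewrite aE bE -rmorphM -rmorphD ler0c.
(* The quotient [- (a x / b x)] is an upper bound of [S] if [b x < 0] and a member of [S] if
   [b x > 0]; multiplying by [b x] gives the same inequality in both cases. If [b x = 0],
   [neutral_ge0] applies directly. *)
have [bx|bx|bx] := ltgtP (b x) 0.
- have : sup S <= - (a x / b x) by apply: ge_sup => //; exact: ubS.
  rewrite -mulrN -invrN ler_pdivlMr ?oppr_gt0 //; lra.
- have : - (a x / b x) <= sup S.
    by apply: ub_le_sup; [exists (- (a y0 / b y0)); exact: ubS | exists x].
  rewrite -mulNr ler_pdivrMr //; lra.
- rewrite bx mulr0 addr0 -ler0c -aE.
  by apply: neutral_ge0; rewrite bE bx.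
Qed.

End SLemma.

(** * Boundedness of a Krein form in a decomposition norm *)

Section KreinSpaces.
Context {R : realType} {F : lmodType R[i]}.
Context (q : {hermitian F for false & Num.conj}).

Lemma krein_norm_ge0 n : krein_norm q n -> forall x, 0 <= n x.
Proof.
move=> [Fp [Fm [[hp hm _ hx] ->]]] x; rewrite /decomposition_norm sqrtC_ge0.
(* The default [(0, 0)] of [xget] makes the radicand zero, which settles that branch. *)
case: xgetP => [[u v] _ [/= Fpu Fmv _]|_ /=]; last by rewrite !linear0r subrr.
case: hp hm => [_ _ hp _] [_ _ hm _]; rewrite addr_ge0 //.
  by have [->|u0] := eqVneq u 0; [rewrite linear0r | exact/ltW/hp].
by have [->|v0] := eqVneq v 0; [rewrite linear0r oppr0 | exact/ltW/hm].
Qed.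

(** Split both arguments: the cross terms vanish by orthogonality, and Cauchy-Schwarz on each
    definite part bounds each of the two remaining terms by [n x * n y]. *)
Lemma krein_form_bound n : krein_norm q n ->
  forall x y, `|q x y| <= 2 * (n x * n y).
Proof.
move=> kn; have n_ge0 := krein_norm_ge0 kn.
case: kn n_ge0 => Fp [Fm [[hp hm horth hx] nE]] n_ge0.
case: (hp) (hm) => [p0 pL pgt0 _] [m0 mL mgt0 _].
have pge0 u : Fp u -> 0 <= q u u.
  by have [->|u0 Fu] := eqVneq u 0; [rewrite linear0r | exact/ltW/pgt0].
have mge0 u : Fm u -> 0 <= - q u u.
  by have [->|u0 Fu] := eqVneq u 0; [rewrite linear0r oppr0 | exact/ltW/mgt0].
have split x : exists u v, [/\ Fp u, Fm v, x = u + v & n x ^+ 2 = q u u - q v v].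
  rewrite nE /decomposition_norm; case: xgetP => [[u v] _ [/= Fu Fv xE]|].
    by exists u, v; rewrite sqrtCK.
  by have [uv [sx _]] := hx x => /(_ uv).
have bound (a s t : R[i]) x y : 0 <= s -> 0 <= t -> s <= n x ^+ 2 ->
    t <= n y ^+ 2 -> `|a| ^+ 2 <= s * t -> `|a| <= n x * n y.
  move=> s0 t0 sx ty ast.
  rewrite -(@ler_pXn2r _ 2) ?nnegrE ?mulr_ge0 // exprMn.
  by apply: le_trans ast _; rewrite ler_pM.
move=> x y.
have [u [v [Fu Fv xE nx]]] := split x; have [u' [v' [Fu' Fv' yE ny]]] := split y.
have -> : q x y = q u u' + q v v'.
  rewrite xE yE !(linearDl, linearDr) /= (horth u v') // (herm_conj q v u').
  by rewrite (horth u' v) // rmorph0 addr0 add0r.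
rewrite mulrDl mul1r (le_trans (ler_normD _ _)) // lerD //.
  apply: (bound _ (q u u) (q u' u')); rewrite ?pge0 ?nx ?ny ?lerDl ?mge0 //.
  apply: (cauchy_schwarz_on (A := Fp)) => //.
    by move=> a z w t; rewrite linearDl linearZl_LR.
  exact: herm_conj.
apply: (bound _ (- q v v) (- q v' v')); rewrite ?mge0 ?nx ?ny ?lerDr ?pge0 //.
rewrite -normrN; apply: (cauchy_schwarz_on (f := fun x y => - q x y) (A := Fm)) => //.
  by move=> a z w t; rewrite linearDl linearZl_LR /= mulrN opprD.
by move=> z w; rewrite rmorphN /= -herm_conj.
Qed.

End KreinSpaces.

(** * Riesz representation by minimization of a quadratic functional *)

Section RealNorm.
Context {R : realType} {V : normedZmodType R[i]}.

Definition rnorm (x : V) : R := complex.Re `|x|.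

Lemma rnormE x : `|x| = (rnorm x)%:C.
Proof. by rewrite RRe_real ?normr_real. Qed.

Lemma rnorm_ge0 x : 0 <= rnorm x.
Proof. by rewrite -ler0c -rnormE. Qed.

End RealNorm.

Section Riesz.
Context {R : realType} {H : completeNormedModType R[i]}.
Context (ip : {dot H for Num.conj}) (H_hilbert : hilbert_space ip).

Lemma hilbert_cauchy_schwarz x y : `|ip x y| <= `|x| * `|y|.
Proof.
rewrite -(@ler_pXn2r _ 2) ?nnegrE ?mulr_ge0 // exprMn !H_hilbert.
apply: (cauchy_schwarz_on (A := setT)) => //.
- by move=> a u v w; rewrite linearDl linearZl_LR.
- exact: (herm_conj ip).
- by move=> u _; rewrite dnorm_gt0.
Qed.

Context (f : H -> R[i]) (M : R).
Hypothesis f_lin : forall a x y, f (a *: x + y) = a * f x + f y.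
Hypothesis f_bounded : forall x, `|f x| <= M%:C * `|x|.

Let ReD (z w : R[i]) : complex.Re (z + w) = complex.Re z + complex.Re w.
Proof. by case: z; case: w. Qed.

Let ReZ (r : R) (z : R[i]) : complex.Re (r%:C * z) = r * complex.Re z.
Proof. by case: z => a b /=; rewrite mul0r subr0. Qed.

Let ReJ (z : R[i]) : complex.Re z^* = complex.Re z.
Proof. by apply: complexI; rewrite !complexRe Re_conj. Qed.

Let Re_ip x : complex.Re (ip x x) = rnorm x ^+ 2.
Proof. by rewrite -H_hilbert rnormE -rmorphXn. Qed.

(* The functional whose minimizer is the Riesz representer of f. *)
Let phi (x : H) : R := complex.Re (ip x x) - 2 * complex.Re (f x).

(** Complete the square in [rnorm x ^+ 2 - 2 * M * rnorm x]. *)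
Let phi_lower x : - M ^+ 2 <= phi x.
Proof.
have Rf : complex.Re (f x) <= M * rnorm x.
  rewrite -lecR rmorphM /= -rnormE; apply: le_trans (f_bounded x).
  by apply: le_trans (normc_ge_Re (f x)); rewrite lecR ler_norm.
rewrite /phi Re_ip; have := sqr_ge0 (M - rnorm x); nra.
Qed.

(** Here [d] is the error of [x] as a representer, tested on [h]. The factor [d^*] makes the
    first-order change real, and negative for [r > 0] and [d != 0]. *)
Let phi_step x h (r : R) : let d := ip h x - f h in
  phi (x + (- r%:C * d^*) *: h) = phi x
    - 2 * r * rnorm d ^+ 2
    + r ^+ 2 * rnorm d ^+ 2 * rnorm h ^+ 2.
Proof.
move=> d; set c := - r%:C * d^*.
have cd : complex.Re (c * d) = - r * rnorm d ^+ 2.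
  rewrite /c -mulrA [d^* * d]mulrC -normCK rnormE -rmorphN -rmorphXn.
  by rewrite -rmorphM.
have cc : c * c^* = (r ^+ 2 * rnorm d ^+ 2)%:C.
  have rJ : (r%:C)^* = r%:C by rewrite conj_Creal //; apply/complex_realP; exists r.
  rewrite /c rmorphM rmorphN /= conjCK rJ rmorphM !rmorphXn /= -rnormE normCK; ring.
rewrite /phi herm_qualD [x + _]addrC f_lin cc !ReD ReJ ReZ !Re_ip.
have -> : f h = ip h x - d by rewrite /d opprB addrC subrK.
have -> : complex.Re (c * (ip h x - d)) = complex.Re (c * ip h x) - complex.Re (c * d).
  by rewrite mulrBr ReD; case: (c * d).
rewrite cd; ring.
Qed.

Let m := inf (range phi).

Let phi_has_inf : has_inf (range phi).
Proof.
split; first by exists (phi 0); exists 0.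
by exists (- M ^+ 2) => _ [x _ <-]; exact: phi_lower.
Qed.

Let inf_phi_le x : m <= phi x.
Proof. by apply: ge_inf; [case: phi_has_inf | exists x]. Qed.

(* Applied to the terms of a minimizing sequence, this shows both that the
   sequence is Cauchy and that its limit represents f.
   Proof: compare phi x with its value at the minimizer of phi on the line x + C h. *)
Let almost_minimizer (x h : H) (e : R) : 0 <= e -> phi x <= m + e ^+ 2 ->
  `|ip h x - f h| <= e%:C * `|h|.
Proof.
move=> e0 xm; set d := ip h x - f h.
rewrite !rnormE -rmorphM lecR.
have [h0|h0] := eqVneq h 0.
  have f0 : f 0 = 0.
    have := f_lin 1 0 0; rewrite scaler0 addr0 mul1r => /eqP.
    by rewrite -subr_eq0 opprD addNKr oppr_eq0 => /eqP.
  have -> : d = 0 by rewrite /d h0 linear0l f0 subrr.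
  by rewrite /rnorm normr0 mulr_ge0 ?rnorm_ge0.
have h1 : 0 < rnorm h by rewrite -ltcR -rnormE normr_gt0.
rewrite -(@ler_pXn2r _ 2) ?nnegrE ?mulr_ge0 ?rnorm_ge0 //.
(* The step [r = (rnorm h ^+ 2)^-1] minimizes the quadratic in [r] of [phi_step]; the decrease is
   [rnorm d ^+ 2 / rnorm h ^+ 2]. *)
have := inf_phi_le (x + (- ((rnorm h ^+ 2)^-1)%:C * d^*) *: h).
rewrite phi_step -/d exprMn => hm.
rewrite -ler_pdivrMr ?exprn_gt0 // (le_trans _ (y := phi x - m)) //; last lra.
rewrite lerBrDr -lerBrDl (le_trans hm) // le_eqVlt; apply/orP; left.
by apply/eqP; field; rewrite gt_eqF.
Qed.

(** The terms of a minimizing sequence represent [f] up to errors tending to 0. Testing two of them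
    on their own difference bounds its norm, so the sequence converges; Cauchy-Schwarz carries the
    error estimate to the limit. *)
Lemma riesz_representation : exists z, forall x, f x = ip x z.
Proof.
(* The excess is a square because [almost_minimizer] takes its root. *)
have /choice[u uP] k : exists x, phi x <= m + k.+1%:R^-1 ^+ 2.
  have e0 : 0 < k.+1%:R^-1 ^+ 2 :> R by rewrite exprn_gt0 ?invr_gt0 ?ltr0n.
  have [_ [x _ <-] /ltW hx] := inf_adherent e0 phi_has_inf.
  by exists x.
have u_almost k h : `|ip h (u k) - f h| <= (k.+1%:R^-1)%:C * `|h|.
  by apply: almost_minimizer; rewrite ?invr_ge0.
have u_dist i j : `|u i - u j| <= (i.+1%:R^-1 + j.+1%:R^-1)%:C.
  have [->|uij] := eqVneq (u i - u j) 0.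
    by rewrite normr0 ler0c addr_ge0 ?invr_ge0.
  rewrite -(@ler_pM2r _ `|u i - u j|) ?normr_gt0 // -expr2 H_hilbert.
  set h := u i - u j.
  have -> : ip h h = (ip h (u i) - f h) - (ip h (u j) - f h).
    by rewrite {2}/h linearBr /= opprB addrA subrK.
  rewrite -[leLHS]ger0_norm; last first.
    by rewrite opprB addrA subrK -linearBr dnorm_ge0.
  by rewrite (le_trans (ler_normB _ _)) // rmorphD mulrDl lerD.
have small e : 0 < e -> exists N, forall k, (N <= k)%N -> k.+1%:R^-1 < e :> R.
  move=> /ltr_add_invr[N]; rewrite add0r => hN; exists N => k Nk.
  by apply: le_lt_trans hN; rewrite lef_pV2 ?posrE // ler_nat.
have epsR (eps : R[i]) : 0 < eps -> exists2 e : R, 0 < e & eps = e%:C.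
  move=> e0; exists (complex.Re eps); last by rewrite RRe_real ?gtr0_real.
  by rewrite -ltcR RRe_real ?gtr0_real.
have : cvg (u @ \oo).
  apply: cauchy_cvg; apply: cauchy_exP => _ /epsR[e e0 ->].
  have [N hN] := small (e / 2) (divr_gt0 e0 (ltr0n _ 2)).
  exists (u N), N => // k /= Nk.
  rewrite -ball_normE /= (le_lt_trans (u_dist _ _)) // ltcR.
  by rewrite [ltRHS]splitr ltrD ?hN.
set z := lim _ => uz; exists z => h.
apply/eqP; rewrite -subr_eq0 -normr_le0 -normrN opprB.
have lim_le e : 0 < e -> rnorm (ip h z - f h) <= rnorm h * (e * 2).
  move=> e0; have [N hN] := small _ e0.
  have e0C : 0 < e%:C by rewrite ltcR.
  have [N' _ hN'] := @cvgr_dist_lt _ _ _ _ _ _ _ uz _ e0C.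
  pose k := maxn N N'.
  have := hN _ (leq_maxl N N'); have := hN' _ (leq_maxr N N'); rewrite /= -/k.
  move=> zu ke; rewrite -lecR -rnormE.
  have -> : ip h z - f h = ip h (z - u k) + (ip h (u k) - f h).
    by rewrite linearBr /= addrA subrK.
  apply: le_trans (ler_normD _ _) _.
  rewrite mulr_natr mulr2n mulrDr rmorphD rmorphM /= -rnormE lerD //.
    by apply: le_trans (hilbert_cauchy_schwarz _ _) _; rewrite ler_wpM2l // ltW.
  by apply: le_trans (u_almost _ _) _; rewrite mulrC ler_wpM2l // lecR ltW.
rewrite rnormE lecR leNgt; apply/negP => d0.
have h0 := rnorm_ge0 h.
have c0 : 0 < 4 * (rnorm h + 1) by rewrite mulr_gt0 ?ltr_wpDl.
set D := rnorm (ip h z - f h) in d0 lim_le.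
(* With this [e], [lim_le] yields [D <= D / 2]; the summand 1 keeps the denominator positive when
   [h = 0]. *)
pose e := D / (4 * (rnorm h + 1)).
have e0 : 0 < e by rewrite divr_gt0.
have DE : D = e * (4 * (rnorm h + 1)) by rewrite divfK ?gt_eqF.
have := lim_le e e0; nra.
Qed.

End Riesz.

(** * Existence and boundedness of the adjoint *)

Section Adjoint.
Context {R : realType} {H : completeNormedModType R[i]} {F : lmodType R[i]}.
Context (ip : {dot H for Num.conj}) (H_hilbert : hilbert_space ip).
Context (q : {hermitian F for false & Num.conj}) (T : {linear H -> F}).
Context (n : F -> R[i]) (kn : krein_norm q n).
Context (M : R) (T_bound : forall x, n (T x) <= M%:C * `|x|).

(** Linearity follows from the definiteness of [ip]. For the bound, the squared norm of [S y] is
    [q (T (S y)) y], to which [krein_form_bound] applies; one factor then cancels. *)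
Lemma bounded_adjoint (S : F -> H) :
  (forall x y, q (T x) y = ip x (S y)) -> bounded_operator n Num.norm S.
Proof.
move=> TS; split.
  move=> a x y; apply/eqP; rewrite -subr_eq0 -(dnorm_eq0 ip); apply/eqP.
  (* Only the first copy of the difference is generalized, so that linearity in the second argument
     can be used against an arbitrary [z]. *)
  move: {1}(_ - _) => z.
  by rewrite linearBr linearDr linearZr_LR /= -!TS linearDr linearZr_LR subrr.
(* The 2 comes from [krein_form_bound]; the absolute value is taken since the sign of [M] is not
   prescribed. *)
exists (2 * `|M|) => y.
have MT x : n (T x) <= `|M|%:C * `|x|.
  by apply: le_trans (T_bound _) _; rewrite ler_wpM2r // lecR ler_norm.
have [->|S0] := eqVneq (S y) 0.
  by rewrite normr0 mulr_ge0 ?(krein_norm_ge0 kn) // ler0c mulr_ge0.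
rewrite -(@ler_pM2r _ `|S y|) ?normr_gt0 // -expr2 H_hilbert -TS.
rewrite -[leLHS]ger0_norm; last by rewrite TS dnorm_ge0.
apply: le_trans (krein_form_bound kn _ _) _.
rewrite rmorphM /= rmorph_nat -!mulrA ler_pM2l // [n y * _]mulrC mulrA.
by rewrite ler_wpM2r ?(krein_norm_ge0 kn).
Qed.

(** Riesz, applied for each [y] to the functional [q (T x) y] of [x], and choice give a candidate;
    [bounded_adjoint] places it in the set from which [adjoint] selects. *)
Lemma adjointP : forall x y, q (T x) y = ip x (adjoint ip q T y).
Proof.
suff [S TS] : exists S, forall x y, q (T x) y = ip x (S y).
  have : is_adjoint ip q T (adjoint ip q T).
    apply: (@xgetPex _ _ [set S | is_adjoint ip q T S]).
    by exists S; split=> //; exists n => //; exact: bounded_adjoint.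
  by case.
have /choice[S TS] y : exists z, forall x, q (T x) y = ip x z.
  apply: (@riesz_representation _ _ _ H_hilbert _ (2 * (M * complex.Re (n y)))).
    by move=> a u v; rewrite linearP linearDl linearZl_LR.
  move=> x; apply: le_trans (krein_form_bound kn _ _) _.
  have ny : n y = (complex.Re (n y))%:C.
    by rewrite RRe_real // ger0_real // (krein_norm_ge0 kn).
  rewrite !rmorphM /= rmorph_nat -ny -!mulrA ler_pM2l //.
  by rewrite [n y * _]mulrC mulrA ler_wpM2r ?(krein_norm_ge0 kn).
by exists S.
Qed.

End Adjoint.

Lemma bounded_operator_comp {R : realType} {U V W : lmodType R[i]}
    (nU : U -> R[i]) (nV : V -> R[i]) (nW : W -> R[i]) f g
    (nV_ge0 : forall v, 0 <= nV v) :
  bounded_operator nU nV f -> bounded_operator nV nW g ->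
  bounded_operator nU nW (g \o f).
Proof.
move=> [flin [M fM]] [glin [N gN]]; split=> [a x y /=|].
  by rewrite flin glin.
exists (`|N| * M) => x /=; rewrite rmorphM /= -mulrA.
apply: le_trans (gN _) _; apply: (@le_trans _ _ (`|N|%:C * nV (f x))).
  by rewrite ler_wpM2r // lecR ler_norm.
by rewrite ler_wpM2l // ler0c.
Qed.

(** This reduces statements about the operator [adjoint ip q T \o T] to statements about the
    quadratic form of [q] along [T]. *)
Lemma bounded_adjoint_comp {R : realType} {H : completeNormedModType R[i]}
    {F : lmodType R[i]} (ip : {dot H for Num.conj})
    (q : {hermitian F for false & Num.conj}) (T : {linear H -> F}) :
  hilbert_space ip -> bounded_to_krein q T ->
  bounded_operator Num.norm Num.norm (adjoint ip q T \o T) /\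
  forall x, ip (adjoint ip q T (T x)) x = q (T x) (T x).
Proof.
move=> hH [n kn [Tlin [M TM]]]; have TS := adjointP hH kn TM; split.
  apply: bounded_operator_comp (bounded_adjoint hH kn TM TS).
    exact: krein_norm_ge0 kn.
  by split=> //; exists M.
by move=> x; rewrite [RHS]herm_conj TS; exact: (herm_conj ip).
Qed.

Theorem proposition3p1 (R : realType)
    (H : completeNormedModType R[i]) (ip : {dot H for Num.conj})
    (K : lmodType R[i]) (qK : {hermitian K for false & Num.conj})
    (E : lmodType R[i]) (qE : {hermitian E for false & Num.conj})
    (T : {linear H -> K}) (V : {linear H -> E})
    (H_hilbert : hilbert_space ip) (H_separable : separable H)
    (K_krein : krein_space qK) (E_krein : krein_space qE)
    (T_bounded : bounded_to_krein qK T) (V_bounded : bounded_to_krein qE V)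
    (T_surj : forall y, exists x, T x = y)
    (V_surj : forall z, exists x, V x = z)
    (VV_indefinite : indefinite ip (adjoint ip qE V \o V)) :
  T @` neutral_preimage qE V `<=` nonneg_vectors qK <->
  exists rho : R,
    bounded_positive ip
      (fun x => adjoint ip qK T (T x) + rho%:C *: adjoint ip qE V (V x)).
Proof.
have [[TT_lin [MT TT_bound]] TTE] := bounded_adjoint_comp H_hilbert T_bounded.
have [[VV_lin [MV VV_bound]] VVE] := bounded_adjoint_comp H_hilbert V_bounded.
have formE (rho : R) x :
    ip (adjoint ip qK T (T x) + rho%:C *: adjoint ip qE V (V x)) x =
    qK (T x) (T x) + rho%:C * qE (V x) (V x).
  by rewrite linearDl linearZl_LR /= TTE VVE.
split=> [TC|[rho [_ pos]] _ [x Vx0 <-]]; last first.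
  by have := pos x; rewrite formE Vx0 mulr0 addr0.
case: VV_indefinite => [nonpos nonneg].
(* The order of [R[i]] is total only on real elements, so negating an inequality below needs real
   values. *)
have real_qE x := herm_real qE (V x).
have [|||rho pos] := @s_lemma _ _ _ _ qK qE T V.
- by move=> x Vx0; apply: TC; exists x.
- apply: contrapT => /forallNP npos; apply: nonneg => x /=.
  by rewrite VVE real_leNgt // ?real0; exact/negP/npos.
- apply: contrapT => /forallNP npos; apply: nonpos => x /=.
  by rewrite VVE real_leNgt // ?real0; exact/negP/npos.
exists rho; split=> [|x]; last by rewrite formE.
split=> [a x y|].
  have /= -> := TT_lin a x y; have /= -> := VV_lin a x y.
  by rewrite !scalerDr !scalerA [rho%:C * a]mulrC addrACA.
exists (MT + `|rho| * MV) => x; apply: le_trans (ler_normD _ _) _.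
rewrite rmorphD mulrDl lerD ?TT_bound // normrZ rmorphM /= -mulrA.
have -> : `|rho%:C| = `|rho|%:C by rewrite normc_def /= expr0n addr0 sqrtr_sqr.
by rewrite ler_wpM2l ?ler0c ?VV_bound.
Qed.
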